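(* Let $G$ be a group, let $(\Gamma,\psi)$ be a $G$-gain graph, let $\pi$ be a unitary representation of $G$ (of finite degree), and let $\alpha=\{C_0,C_1,\ldots,C_k\}$ be a $\pi$-GM partition of $V_\Gamma$, with associated matrix $Q_\alpha$ and associated switched gain graph $(\Gamma,\psi)^\alpha=(\Gamma^\alpha,\psi^\alpha)$. Then $$\pi(A_{(\Gamma^\alpha,\psi^\alpha)})=\pi(Q_\alpha)\,\pi(A_{(\Gamma,\psi)})\,\pi(Q_\alpha).$$ In particular, $(\Gamma,\psi)$ and $(\Gamma,\psi)^\alpha$ are $\pi$-cospectral.
   Context: **Group algebra and representations.** $G$ is an arbitrary group with unit $1_G$; $\mathbb{C}G$ is its group algebra; $M_n(\mathbb{C}G)$ the algebra of $n\times n$ matrices over it. A representation of degree $d$ is a homomorphism $\pi\colon G\to GL_d(\mathbb{C})$; it is unitary if all $\pi(g)$ are unitary matrices. $\pi$ is extended linearly to $\pi\colon\mathbb{C}G\to M_d(\mathbb{C})$, and then to $\pi\colon M_n(\mathbb{C}G)\to M_{nd}(\mathbb{C})$ by replacing each entry $a_{i,j}$ with the $d\times d$ block $\pi(a_{i,j})$. **Gain graphs.** $\Gamma=(V_\Gamma,E_\Gamma)$ is a finite simple graph; $u\sim v$ means $u,v$ are adjacent. A $G$-gain graph $(\Gamma,\psi)$ consists of $\Gamma$ and a map $\psi$ from ordered pairs of adjacent vertices to $G$ with $\psi(u,v)=\psi(v,u)^{-1}$. Fixing an ordering $v_1,\dots,v_n$ of $V_\Gamma$, its adjacency matrix $A_{(\Gamma,\psi)}\in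 M_n(\mathbb{C}G)$ has $(i,j)$ entry $\psi(v_i,v_j)$ if $v_i\sim v_j$ and $0$ otherwise. For $\pi$ unitary, $\pi(A_{(\Gamma,\psi)})$ is a Hermitian complex matrix; its spectrum (with multiplicities) is the $\pi$-spectrum of $(\Gamma,\psi)$. Two $G$-gain graphs are $\pi$-cospectral if they have the same $\pi$-spectrum. **$\pi$-GM partition.** For a partition $\alpha=\{C_0,C_1,\dots,C_k\}$ of $V_\Gamma$ and $v\in V_\Gamma$, put $\Psi_i(v)=\sum_{w\in C_i,\,w\sim v}\psi(v,w)\in\mathbb{C}G$. $\alpha$ is a $\pi$-GM partition if: - for all $i,j\in\{1,\dots,k\}$ and all $v,v'\in C_i$, $\pi(\Psi_j(v))=\pi(\Psi_j(v'))$; - for every $v\in C_0$ and every $i\in\{1,\dots,k\}$ there exist $g_1,g_2\in G\cup\{0\}\subset\mathbb{C}G$ such that $\Psi_i(v)=\frac{|C_i|}{2}g_1+\frac{|C_i|}{2}g_2$. **Switched graph.** $(\Gamma,\psi)^\alpha=(\Gamma^\alpha,\psi^\alpha)$ is the $G$-gain graph on the same vertex set such that: adjacencies and gains between pairs of vertices of $\bigcup_{i=1}^k C_i$, and between pairs of vertices of $C_0$, are the same as in $(\Gamma,\psi)$; for $v\in C_0$, $i\in\{1,\dots,k\}$ with $\Psi_i(v)=\frac{|C_i|}{2}g_1+\frac{|C_i|}{2}g_2$, $g_1,g_2\in G\cup\{0\}$, and $w\in C_i$, one sets $\psi^\alpha(v,w)=g_1$ if $\psi(v,w)=g_2$ and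 $\psi^\alpha(v,w)=g_2$ if $\psi(v,w)=g_1$ (and $\psi^\alpha(w,v)=\psi^\alpha(v,w)^{-1}$), with the convention that the value $0$ means the two vertices are not adjacent. The same vertex ordering is used for both adjacency matrices. **Matrix $Q_\alpha$.** With $n_i=|C_i|$, $Q_\alpha\in M_n(\mathbb{C}G)$ is indexed by $V_\Gamma$ with entries $(Q_\alpha)_{u,v}=1_G$ if $u=v\in C_0$; $\frac{2-n_i}{n_i}1_G$ if $u=v\in C_i$, $i\ge1$; $\frac{2}{n_i}1_G$ if $u\neq v$, $u,v\in C_i$, $i\ge 1$; and $0$ otherwise. *)

(* Defs.v *)
From HB Require Import structures.
From mathcomp Require Import all_boot all_order all_algebra.
From mathcomp Require Import boolp classical_sets.
From mathcomp.finmap Require Import finmap.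
From mathcomp.multinomials Require Import monalg.

Set Implicit Arguments.
Unset Strict Implicit.
Unset Printing Implicit Defensive.

Import Order.TTheory GRing.Theory Num.Theory.
Local Open Scope ring_scope.

(* The definitions are stated over any numClosedFieldType C, to be instantiated
   with the complex numbers R[i]. {malg C[G]} is the space of finitely supported
   functions G -> C, that is, the group algebra of G; only its vector space
   structure is used below. *)

(* A homomorphism from G to GL_d(C). *)
Record representation (C : numClosedFieldType) (G : groupType) (d : nat) := Representation {
  rep_fun :> G -> 'M[C]_d;
  rep_unit : forall g, rep_fun g \in unitmx;
  repM : forall g h, rep_fun (g * h)%g = rep_fun g *m rep_fun h
}.

Definition unitary_rep (C : numClosedFieldType) (G : groupType) (d : nat)
    (pi : representation C G d) : Prop :=
  forall g, pi g \is unitarymx.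

(* Linear extension of pi to the group algebra. *)
Definition rep_alg (C : numClosedFieldType) (G : groupType) (d : nat)
    (pi : representation C G d) (a : {malg C[G]}) : 'M[C]_d :=
  \sum_(g <- msupp a) a@_g *: pi g.

(* Block-wise extension to n x n matrices; the size \sum_(i < n) d is n * d. *)
Definition rep_mx (C : numClosedFieldType) (G : groupType) (d : nat)
    (pi : representation C G d) (n : nat) (A : 'M[{malg C[G]}]_n) :
    'M[C]_(\sum_(i < n) d) :=
  \mxblock_(i < n, j < n) rep_alg pi (A i j).

Record simple_graph (V : finType) := SimpleGraph {
  adj :> rel V;
  adj_sym : symmetric adj;
  adj_irrefl : irreflexive adj
}.

(* The values of gain on non-adjacent pairs are junk and never used. *)
Record gain_graph (G : groupType) (V : finType) := GainGraph {
  graph : simple_graph V;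
  gain : V -> V -> G;
  gainV : forall u v, graph u v -> gain u v = (gain v u)^-1%g
}.

(* option G stands for the subset G U {0} of the group algebra, None being 0. *)
Definition of_option (C : numClosedFieldType) (G : groupType) (x : option G) :
    {malg C[G]} :=
  if x is Some g then << g >> else 0.

(* The gain, with the convention that 0 means "not adjacent". *)
Definition gain0 (G : groupType) (V : finType) (X : gain_graph G V) (u v : V) :
    option G :=
  if graph X u v then Some (gain X u v) else None.

Section GainGraphs.

Variables (C : numClosedFieldType) (G : groupType) (V : finType).
Implicit Types (X : gain_graph G V).

(* The ordering v_1, ..., v_n of the vertices is the map v, to be a bijection. *)
Definition adj_mx (n : nat) (v : 'I_n -> V) X : 'M[{malg C[G]}]_n :=
  \matrix_(i, j)
    (if graph X (v i) (v j) then << gain X (v i) (v j) >> else 0).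

Variable k : nat.

(* A map alpha : V -> {0, ..., k} stands for the partition {C_0, ..., C_k} with
   C_i = cell alpha i. *)
Implicit Types (alpha : V -> 'I_k.+1) (i : 'I_k.+1).

Definition cell alpha i : {set V} := [set w | alpha w == i].

Definition Psi X alpha i (v : V) : {malg C[G]} :=
  \sum_(w in cell alpha i | graph X v w) << gain X v w >>.

Definition half_decomp X alpha i (v : V) (g : option G * option G) : Prop :=
  Psi X alpha i v =
    (#|cell alpha i|%:R / 2) *: of_option C g.1
      + (#|cell alpha i|%:R / 2) *: of_option C g.2.

(* C_0 is allowed to be empty. *)
Definition gm_partition (d : nat) (pi : representation C G d) X alpha : Prop :=
  [/\ forall i, i != ord0 -> cell alpha i != finset.set0,
      forall i j, i != ord0 -> j != ord0 ->
        forall v v', v \in cell alpha i -> v' \in cell alpha i ->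
          rep_alg pi (Psi X alpha j v) = rep_alg pi (Psi X alpha j v')
    & forall v i, v \in cell alpha ord0 -> i != ord0 ->
        exists g1 g2 : option G, half_decomp X alpha i v (g1, g2)].

Definition swap (g : option G * option G) (x : option G) : option G :=
  if x == g.1 then g.2 else if x == g.2 then g.1 else x.

(* A pair (g1, g2) with Psi_i(v) = |C_i|/2 g1 + |C_i|/2 g2, if there is one. By
   swap_half_decomp below, the choice of the pair is immaterial. *)
Definition half_pair X alpha i (v : V) : option G * option G :=
  xget (None, None) [set g | half_decomp X alpha i v g]%classic.

Definition switched_gain0 X alpha (v w : V) : option G :=
  if (alpha v == ord0) && (alpha w != ord0) then
    swap (half_pair X alpha (alpha w) v) (gain0 X v w)
  else if (alpha v != ord0) && (alpha w == ord0) then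
    omap (fun g => g^-1)%g (swap (half_pair X alpha (alpha v) w) (gain0 X w v))
  else gain0 X v w.

Lemma gain0V X u v : gain0 X u v = omap (fun g => g^-1)%g (gain0 X v u).
Proof.
rewrite /gain0 adj_sym; case: ifP => //= vu.
by rewrite (@gainV _ _ X u v) // adj_sym.
Qed.

Lemma switched_gain0V X alpha u v :
  switched_gain0 X alpha u v = omap (fun g => g^-1)%g (switched_gain0 X alpha v u).
Proof.
rewrite /switched_gain0; case: (alpha u == _); case: (alpha v == _) => //=;
  rewrite -?gain0V //.
by case: (swap _ _) => //= g; rewrite invgK.
Qed.

Definition switched_adj X alpha : rel V :=
  fun u v => switched_gain0 X alpha u v != None.

Lemma switched_adj_sym X alpha : symmetric (switched_adj X alpha).
Proof.
by move=> u v; rewrite /switched_adj switched_gain0V; case: switched_gain0.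
Qed.

Lemma switched_adj_irrefl X alpha : irreflexive (switched_adj X alpha).
Proof.
move=> u; rewrite /switched_adj /switched_gain0 andbN andNb /gain0.
by rewrite adj_irrefl.
Qed.

Lemma switched_gainV X alpha u v : switched_adj X alpha u v ->
  odflt 1%g (switched_gain0 X alpha u v)
    = (odflt 1%g (switched_gain0 X alpha v u))^-1%g.
Proof.
by rewrite /switched_adj (switched_gain0V X alpha u v); case: switched_gain0.
Qed.

Definition switched X alpha : gain_graph G V :=
  @GainGraph G V
    (SimpleGraph (@switched_adj_sym X alpha) (@switched_adj_irrefl X alpha))
    (fun u v => odflt 1%g (switched_gain0 X alpha u v))
    (@switched_gainV X alpha).

Definition Q_mx (n : nat) (v : 'I_n -> V) alpha : 'M[{malg C[G]}]_n :=
  \matrix_(i, j)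
    let u := v i in let w := v j in
    let m : C := #|cell alpha (alpha u)|%:R in
    if alpha u == ord0 then (if u == w then << 1%g >> else 0)
    else if u == w then ((2 - m) / m) *: << 1%g >>
    else if alpha u == alpha w then (2 / m) *: << 1%g >>
    else 0.

End GainGraphs.

Arguments adj_mx C {G V n} v X.
Arguments switched C {G V k} X alpha.
Arguments Q_mx C G {V k n} v alpha.

(* The spectrum of M as a multiset: each number is mapped to its algebraic
   multiplicity as an eigenvalue of M. *)
Definition spectrum (C : numClosedFieldType) (n : nat) (M : 'M[C]_n) : C -> nat :=
  fun x => mup x (char_poly M).

Definition pi_spectrum (C : numClosedFieldType) (G : groupType) (d : nat)
    (pi : representation C G d) (V : finType) (n : nat) (v : 'I_n -> V)
    (X : gain_graph G V) : C -> nat :=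
  spectrum (rep_mx pi (adj_mx C v X)).

Definition pi_cospectral (C : numClosedFieldType) (G : groupType) (d : nat)
    (pi : representation C G d)
    (V : finType) (n : nat) (v : 'I_n -> V) (X : gain_graph G V)
    (V' : finType) (n' : nat) (v' : 'I_n' -> V') (X' : gain_graph G V') : Prop :=
  pi_spectrum pi v X =1 pi_spectrum pi v' X'.

Lemma mcoeff_scale2 (F : fieldType) (G : choiceType) (c : F)
    (x y : {malg F[G]}) (a : G) :
  (c *: x + c *: y)@_a = c * (x@_a + y@_a).
Proof. by rewrite mcoeffD !mcoeffZ mulrDr. Qed.

(* The choice of the pair (g1, g2) in half_pair is immaterial. *)
Lemma swap_half_decomp (C : numClosedFieldType) (G : groupType) (V : finType) (k : nat)
    (X : gain_graph G V) (alpha : V -> 'I_k.+1) (i : 'I_k.+1) (v : V)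
    (g h : option G * option G) :
  cell alpha i != finset.set0 ->
  half_decomp C X alpha i v g -> half_decomp C X alpha i v h ->
  swap g =1 swap h.
Proof.
move=> ne; rewrite /half_decomp => -> /malgP E x.
have nz : (#|cell alpha i|%:R / 2 : C) != 0.
  by rewrite mulf_neq0 ?invr_eq0 ?pnatr_eq0 // -lt0n card_gt0.
have {}E a : ((g.1 == Some a) + (g.2 == Some a) =
              (h.1 == Some a) + (h.2 == Some a))%N.
  move: (E a); rewrite !mcoeff_scale2 => /(mulfI nz).
  have cE y : (of_option C y)@_a = (y == Some a)%:R.
    by case: y => [b|] /=; rewrite ?mcoeff0 // mcoeffU.
  by rewrite !cE -!natrD => /eqP; rewrite eqr_nat => /eqP.
case: g h E {ne nz} => [g1 g2] [h1 h2] /= E.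
have optP (y z : option G) :
    (forall a, ((y == Some a) = (z == Some a) :> nat)) -> y = z.
  case: y => [a|] yz; first by have := yz a; rewrite eqxx; case: eqP.
  by case: z yz => // a yz; have := yz a; rewrite eqxx.
suff [[-> ->]|[-> ->]] : (g1 = h1 /\ g2 = h2) \/ (g1 = h2 /\ g2 = h1).
- by [].
- by rewrite /swap /=; case: eqP => [->|_]; case: eqP.
have [eg|n1] := eqVneq g1 h1.
  left; split=> //; apply: optP => a; apply: (@addnI (g1 == Some a)).
  by rewrite E eg.
have [eg|n2] := eqVneq g1 h2.
  right; split=> //; apply: optP => a; apply: (@addnI (g1 == Some a)).
  by rewrite E eg addnC.
exfalso; case: g1 => [a|] in E n1 n2 *.
  by have := E a; rewrite eqxx (eq_sym h1) (eq_sym h2) (negbTE n1) (negbTE n2).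
case: h1 h2 => [b|] [c|] // in E n1 n2 *.
have := E b; have := E c; rewrite !eqxx !add0n.
case: eqP => [->|_]; last by case: eqP.
by rewrite (eq_sym (Some b)); case: eqP.
Qed.

Lemma gain0_switchedE (C : numClosedFieldType) (G : groupType) (V : finType) (k : nat)
    (X : gain_graph G V) (alpha : V -> 'I_k.+1) (u v : V) :
  gain0 (switched C X alpha) u v = switched_gain0 C X alpha u v.
Proof.
by rewrite /gain0 /= /switched_adj; case: switched_gain0.
Qed.

(* Exchanging g1 and g2 between C_0 and C_i characterizes the switched graph, for
   any decomposition of Psi_i(v). *)
Lemma gain0_switched (C : numClosedFieldType) (G : groupType) (V : finType) (k : nat)
    (X : gain_graph G V) (alpha : V -> 'I_k.+1) (i : 'I_k.+1) (v w : V)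
    (g1 g2 : option G) :
  i != ord0 -> v \in cell alpha ord0 -> w \in cell alpha i ->
  half_decomp C X alpha i v (g1, g2) ->
  (gain0 X v w = g2 -> gain0 (switched C X alpha) v w = g1) /\
  (gain0 X v w = g1 -> gain0 (switched C X alpha) v w = g2).
Proof.
move=> i0; rewrite !inE => v0 /eqP wi dec.
have ne : cell alpha i != finset.set0.
  by apply/set0Pn; exists w; rewrite inE wi.
rewrite gain0_switchedE /switched_gain0 v0 wi i0 /=.
have hp : half_decomp C X alpha i v (half_pair C X alpha i v).
  by rewrite /half_pair; case: xgetP => [g -> //|/(_ (g1, g2))/(_ dec)].
rewrite (swap_half_decomp ne hp dec).
by rewrite /swap /=; split=> ->; rewrite eqxx //; case: eqP.
Qed.

(* Main.v *)
Require Import Defs.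
From HB Require Import structures.
From mathcomp Require Import all_boot all_order all_algebra.
From mathcomp Require Import boolp classical_sets reals.
From mathcomp Require Import complex.
From mathcomp.finmap Require Import finmap.
From mathcomp.multinomials Require Import monalg.
From mathcomp Require Import spectral.
Import Order.TTheory GRing.Theory Num.Theory.

(** The blocks of [pi(Q)] are scalar matrices, so left and right multiplication
    by [pi(Q)] only mix blocks whose indices lie in the same cell: they act on
    the block rows, resp. columns, by [cell_reflection]. This map fixes [f] on
    [C_0], and on a cell [C_i] it sends [f] to twice its mean over [C_i] minus
    [f]. It is an involution since it preserves the means; hence
    [pi(Q)^2 = 1], and the product formula makes the two matrices similar, which
    gives cospectrality ([switched_cospectral]).

    The product formula is checked block by block ([switched_block]).
    - Between two vertices of [C_0] nothing changes on either side.
    - Let [u] be in [C_0] and [w] in [C_i]. As Psi_i(u) is half of [n_i] times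
      [g1 + g2], twice the mean over [C_i] of the blocks in row [u] is
      [pi g1 + pi g2]. Each of these blocks is [pi g1] or [pi g2]
      ([half_decomp_gain]), and [x |-> g1 + g2 - x] exchanges these two: this is
      switching ([switched_block_C0]). The case of [C_i] and [C_0] is the
      adjoint of this one, because [pi] is unitary.
    - Let [u] be in [C_i] and [w] in [C_j]. The partition condition says that
      the block [(C_i, C_j)] has constant row sums [r], and by taking adjoints
      also constant column sums [c]. Counting the total in two ways gives
      [n_i r = n_j c] ([cell_double_sum]), so that the correction terms made by
      the two reflections cancel and the block is unchanged. *)

Local Open Scope ring_scope.
Local Open Scope complex_scope.
Local Open Scope sesquilinear_scope.

Set Implicit Arguments.
Unset Strict Implicit.
Unset Printing Implicit Defensive.

(** * The linear extension of a representation *)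

Section Representations.

Variables (C : numClosedFieldType) (G : groupType) (d : nat).
Variable pi : representation C G d.

Lemma rep1 : pi 1%g = 1%:M.
Proof.
have /(congr1 (mulmx (invmx (pi 1%g)))) := repM pi 1%g 1%g.
by rewrite mulg1 mulmxA mulVmx ?rep_unit // mul1mx.
Qed.

Lemma repV g : pi g^-1%g = invmx (pi g).
Proof.
apply: (can_inj (mulKmx (rep_unit pi g))).
by rewrite -repM mulgV rep1 mulmxV ?rep_unit.
Qed.

(** The sum that defines [rep_alg pi a] may range over any finite set containing
    the support of [a]; a common set for several [a] is what makes linearity
    a term by term computation. *)
Lemma rep_algEw (D : {fset G}) (a : {malg C[G]}) :
  (msupp a `<=` D)%fset -> rep_alg pi a = \sum_(g <- D) a@_g *: pi g.
Proof.
move=> sD; rewrite /rep_alg (big_fset_incl _ sD) //= => g _ /mcoeff_outdom ->.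
by rewrite scale0r.
Qed.

Lemma rep_alg_is_linear : linear (rep_alg pi).
Proof.
move=> c a b; pose D := (msupp a `|` msupp b)%fset.
have sa : (msupp a `<=` D)%fset by apply: fsubsetUl.
have sb : (msupp b `<=` D)%fset by apply: fsubsetUr.
have sab : (msupp (c *: a + b)%R `<=` D)%fset.
  apply: (fsubset_trans (msuppD_le _ _)).
  by rewrite fsubUset sb (fsubset_trans (msuppZ_le _ _)).
rewrite !(@rep_algEw D) // scaler_sumr -big_split /=; apply: eq_bigr => g _.
by rewrite mcoeffD mcoeffZ scalerDl scalerA.
Qed.

HB.instance Definition _ :=
  GRing.isLinear.Build C {malg C[G]} 'M[C]_d _ (rep_alg pi) rep_alg_is_linear.

Lemma rep_algU g : rep_alg pi << g >> = pi g.
Proof.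
by rewrite (@rep_algEw [fset g]%fset) ?msuppU_le // big_seq_fset1 mcoeffUU scale1r.
Qed.

Definition rep_opt (x : option G) : 'M[C]_d := rep_alg pi (of_option C x).

Lemma rep_optV x : unitary_rep pi ->
  rep_opt (omap (fun g => g^-1)%g x) = (rep_opt x)^t*.
Proof.
case: x => [g|] hpi; rewrite /rep_opt /=.
  by rewrite !rep_algU repV invmx_unitary.
by rewrite linear0 trmx0 map_mx0.
Qed.

End Representations.

(** * Blocks of the adjacency matrix *)

(** Its linear extension is the augmentation of the group algebra: it turns an
    identity between sums of gains into an identity between numbers of edges. *)
Definition trivial_rep (C : numClosedFieldType) (G : groupType) :
    representation C G 1 :=
  Representation (fun _ => unitmx1 C 1) (fun _ _ => esym (mulmx1 _)).

Section GainBlocks.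

Variables (C : numClosedFieldType) (G : groupType) (V : finType) (d : nat).
Variable pi : representation C G d.
Implicit Type X : gain_graph G V.

Definition gain_block X (u w : V) : 'M[C]_d := rep_opt pi (gain0 X u w).

Lemma gain_blockC X u w : unitary_rep pi ->
  gain_block X u w = (gain_block X w u)^t*.
Proof. by move=> hpi; rewrite /gain_block gain0V rep_optV. Qed.

Lemma rep_Psi (k : nat) X (alpha : V -> 'I_k.+1) i u :
  rep_alg pi (Psi C X alpha i u) = \sum_(w in cell alpha i) gain_block X u w.
Proof.
rewrite linear_sum /= big_mkcondr; apply: eq_bigr => w _.
by rewrite /gain_block /rep_opt /gain0; case: ifP => //= _; rewrite linear0.
Qed.

Lemma rep_Psi_adj (k : nat) X (alpha : V -> 'I_k.+1) i w : unitary_rep pi ->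
  (rep_alg pi (Psi C X alpha i w))^t* = \sum_(u in cell alpha i) gain_block X u w.
Proof.
move=> hpi; rewrite rep_Psi linear_sum /= map_mx_sum.
by apply: eq_bigr => u _; rewrite -gain_blockC.
Qed.

End GainBlocks.

(** * The gains between C_0 and another cell *)

Section HalfDecomposition.

Variables (C : numClosedFieldType) (G : groupType) (V : finType) (k : nat).
Variables (X : gain_graph G V) (alpha : V -> 'I_k.+1) (i : 'I_k.+1) (u : V).
Variable g : option G * option G.
Hypothesis dec : half_decomp C X alpha i u g.

(** Half of [n_i] times [g1 + g2], as an element of the group algebra, leaves no
    room for a third kind of gain. A gain [a] other than [g1] and [g2] would have
    a positive coefficient on the left of the decomposition and a zero one on
    the right. A missing edge when neither [g1] nor [g2] is 0 would contradict
    the augmentation, which says that [u] then has [n_i] neighbours in the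
    cell. *)
Lemma half_decomp_gain w : w \in cell alpha i ->
  (gain0 X u w == g.1) || (gain0 X u w == g.2).
Proof.
move=> wi; apply/negPn/negP; rewrite negb_or => /andP[n1 n2].
have m0 : (#|cell alpha i|%:R : C) != 0.
  by rewrite pnatr_eq0 -lt0n; apply/card_gt0P; exists w.
case E: (gain0 X u w) => [a|] in n1 n2.
  (* Compare the coefficients of a; those of Psi are sums of nonnegative terms. *)
  have := congr1 (mcoeff a) dec; rewrite mcoeff_scale2.
  have cE (x : option G) : (of_option C x)@_a = (Some a == x)%:R.
    by case: x => [b|] /=; rewrite ?mcoeff0 // mcoeffU eq_sym.
  rewrite !cE (negbTE n1) (negbTE n2) addr0 mulr0 raddf_sum /= => /eqP.
  rewrite psumr_eq0 => [|x _]; last by rewrite mcoeffU ler0n.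
  move=> /allP /(_ w (mem_index_enum w)) /implyP.
  move: E; rewrite /gain0; case: ifP => // _ [ga].
  by rewrite wi ga => /(_ isT); rewrite mcoeffUU oner_eq0.
(* Compare the augmentations: w is missing from the count of neighbours. *)
have := congr1 (rep_alg (trivial_rep C G)) dec.
rewrite rep_Psi linearD !linearZ /=.
have augE (x : option G) : rep_alg (trivial_rep C G) (of_option C x)
    = (x != None)%:R%:M :> 'M_1.
  by case: x => [b|] /=; rewrite ?rep_algU ?linear0 // raddf0.
rewrite !augE !(eq_sym _ None) n1 n2 -scalerDl -splitr.
rewrite (bigD1 w) //= /gain_block E {1}/rep_opt linear0 add0r.
under eq_bigr do rewrite /rep_opt augE.
rewrite -raddf_sum scalemx1 => /matrixP/(_ ord0 ord0); rewrite !mxE eqxx.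
rewrite !mulr1n => /eqP; rewrite -natr_sum eqr_nat => /eqP; apply/eqP.
rewrite neq_ltn; apply/orP; left.
rewrite (cardsD1 w) wi add1n ltnS -sum1_card.
apply: (@leq_trans (\sum_(j in cell alpha i | j != w) 1)).
  by apply: leq_sum => j _; case: (_ != _).
by rewrite leq_eqVlt; apply/orP; left; apply/eqP/eq_bigl => x; rewrite !inE andbC.
Qed.

End HalfDecomposition.

Lemma swapD (G : groupType) (M : zmodType) (F : option G -> M)
    (g : option G * option G) (x : option G) :
  (x == g.1) || (x == g.2) -> F (swap g x) = F g.1 + F g.2 - F x.
Proof.
rewrite /swap; case: eqP => [-> _|_ /= /eqP ->].
  by rewrite addrAC subrr add0r.
by rewrite eqxx addrK.
Qed.

(** * The reflection attached to a partition *)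

Section CellReflection.

Variables (C : numClosedFieldType) (V : finType) (k : nat).
Variable alpha : V -> 'I_k.+1.

Let m (u : V) : C := #|cell alpha (alpha u)|%:R.

Lemma card_cell_neq0 u : #|cell alpha (alpha u)|%:R != 0 :> C.
Proof. by rewrite pnatr_eq0 -lt0n; apply/card_gt0P; exists u; rewrite inE. Qed.

(** This is how Q_alpha acts on families indexed by the vertices; the values are
    in an arbitrary module so that it applies to rows and columns of blocks. *)
Definition cell_reflection (M : lmodType C) (f : V -> M) (u : V) : M :=
  if alpha u == ord0 then f u
  else (2 / m u) *: \sum_(w in cell alpha (alpha u)) f w - f u.

Lemma eq_cell_reflection (M : lmodType C) (f f' : V -> M) :
  f =1 f' -> cell_reflection f =1 cell_reflection f'.
Proof.
by move=> e u; rewrite /cell_reflection e; under eq_bigr do rewrite e.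
Qed.

(** On a cell other than [C_0] the map keeps the mean [mu] and sends [f] to
    [2 mu - f]. *)
Lemma cell_reflectionK (M : lmodType C) (f : V -> M) :
  cell_reflection (cell_reflection f) =1 f.
Proof.
move=> u; rewrite {1}/cell_reflection; case: ifP => u0.
  by rewrite /cell_reflection u0.
(* The reflection does not change the sum over a cell. *)
have eS : \sum_(w in cell alpha (alpha u)) cell_reflection f w
          = \sum_(w in cell alpha (alpha u)) f w.
  set S := RHS.
  transitivity (\sum_(w in cell alpha (alpha u)) ((2 / m u) *: S - f w)).
    apply: eq_bigr => w; rewrite inE => /eqP e.
    by rewrite /cell_reflection /m e u0.
  rewrite sumrB sumr_const -scaler_nat scalerA mulrC divfK ?card_cell_neq0 //.
  by rewrite -/S scaler_nat mulr2n addrK.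
by rewrite eS /cell_reflection u0 opprB addrC subrK.
Qed.

(** The entries of Q_alpha: with this form of the diagonal,
    [(2 - m) / m = 2 / m - 1], one formula covers the whole cell. *)
Definition Q_coef (u w : V) : C :=
  if alpha u == ord0 then (u == w)%:R
  else (2 / m u) * (alpha u == alpha w)%:R - (u == w)%:R.

Lemma Q_coefC u w : Q_coef u w = Q_coef w u.
Proof.
rewrite /Q_coef /m (eq_sym w u) (eq_sym (alpha w) (alpha u)).
have [->//|_] := eqVneq u w; have [->//|nw] := eqVneq (alpha u) (alpha w).
by rewrite !mulr0 subr0 !if_same.
Qed.

Lemma sum_Q_coef (M : lmodType C) (f : V -> M) u :
  \sum_w Q_coef u w *: f w = cell_reflection f u.
Proof.
have delta : \sum_w (u == w)%:R *: f w = f u.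
  rewrite (bigD1 u) //= eqxx scale1r big1 ?addr0 // => w.
  by rewrite eq_sym => /negbTE ->; rewrite scale0r.
rewrite /Q_coef /cell_reflection; case: ifP => // u0.
under eq_bigr do rewrite scalerBl -scalerA.
rewrite sumrB delta -scaler_sumr; congr (_ *: _ - _).
rewrite [RHS]big_mkcond; apply: eq_bigr => w _.
by rewrite inE eq_sym; case: ifP; rewrite ?scale1r ?scale0r.
Qed.

End CellReflection.

(** * Block matrices indexed by the vertices *)

Section VertexBlocks.

Variables (C : numClosedFieldType) (V : finType) (d n : nat).
Variables (v : 'I_n -> V) (hv : bijective v).

Definition vertex_block (B : V -> V -> 'M[C]_d) : 'M[C]_(\sum_(i < n) d) :=
  \mxblock_(i < n, j < n) B (v i) (v j).

Lemma eq_vertex_block B B' : B =2 B' -> vertex_block B = vertex_block B'.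
Proof. by move=> e; apply: eq_mxblock => i j; apply: e. Qed.

Lemma mul_vertex_block B B' :
  vertex_block B *m vertex_block B'
    = vertex_block (fun u w => \sum_x B u x *m B' x w).
Proof.
rewrite mul_mxblock; apply: eq_mxblock => i j.
by rewrite [RHS](reindex v) //; apply: onW_bij.
Qed.

Lemma vertex_block1 : vertex_block (fun u w => (u == w)%:R *: 1%:M) = 1%:M.
Proof.
rewrite -mxdiagZ /mxdiag; apply: eq_mxblock => i j.
rewrite (inj_eq (bij_inj hv)); case: eqP => _.
  by rewrite scale1r conform_mx_id.
by rewrite scale0r.
Qed.

Variables (k : nat) (alpha : V -> 'I_k.+1).

Let Q := vertex_block (fun u w => Q_coef C alpha u w *: 1%:M).

Lemma mul_Q_vertex_block B : Q *m vertex_block B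
  = vertex_block (fun u w => cell_reflection alpha (B^~ w) u).
Proof.
rewrite mul_vertex_block; apply: eq_vertex_block => u w.
by rewrite -sum_Q_coef; apply: eq_bigr => x _; rewrite -scalemxAl mul1mx.
Qed.

Lemma mul_vertex_block_Q B : vertex_block B *m Q
  = vertex_block (fun u => cell_reflection alpha (B u)).
Proof.
rewrite mul_vertex_block; apply: eq_vertex_block => u w.
rewrite -sum_Q_coef; apply: eq_bigr => x _.
by rewrite -scalemxAr mulmx1 Q_coefC.
Qed.

(** [Q] is the product of [Q] and the identity, that is the reflection of the
    identity matrix; reflecting once more gives the identity back. *)
Lemma Q_involutive : Q *m Q = 1%:M.
Proof.
rewrite -{2}[Q]mulmx1 -vertex_block1 !mul_Q_vertex_block.
by apply: eq_vertex_block => u w; rewrite cell_reflectionK.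
Qed.

End VertexBlocks.

Lemma char_poly_involution_conj (C : comNzRingType) (n : nat) (P A : 'M[C]_n) :
  P *m P = 1%:M -> char_poly (P *m A *m P) = char_poly A.
Proof.
move=> PP; pose P' := map_mx (@polyC C) P.
have PP' : P' *m P' = 1%:M by rewrite -map_mxM PP map_mx1.
have e : char_poly_mx (P *m A *m P) = P' *m char_poly_mx A *m P'.
  rewrite /char_poly_mx mulmxBr mulmxBl !map_mxM; congr (_ - _).
  by rewrite -mulmxA -scalar_mxC mulmxA PP' mul1mx.
by rewrite /char_poly e !det_mulmx mulrAC -det_mulmx PP' det1 mul1r.
Qed.

(** * The switched graph *)

Section Switching.

Variables (C : numClosedFieldType) (G : groupType) (V : finType).
Variables (X : gain_graph G V) (d : nat) (pi : representation C G d).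
Variables (k : nat) (alpha : V -> 'I_k.+1).
Hypotheses (hpi : unitary_rep pi) (gm : gm_partition pi X alpha).

Let B := gain_block pi X.
Let B' := gain_block pi (switched C X alpha).
Let R := @cell_reflection C V k alpha 'M[C]_d.

(** Twice the mean over the cell of the blocks [B u] is [pi g1 + pi g2], and the
    exchange of [g1] and [g2] is the reflection [x |-> g1 + g2 - x]. *)
Lemma switched_block_C0 u w : alpha u = ord0 -> B' u w = R (B u) w.
Proof.
move=> u0; rewrite /B' /R /gain_block gain0_switchedE /switched_gain0.
rewrite /cell_reflection u0 eqxx /=; case: (eqVneq (alpha w) ord0) => //= w0.
case: gm => _ _ /(_ u (alpha w)); rewrite inE u0 eqxx w0.
move=> /(_ isT isT) [g1 [g2 dec]].
have hp : half_decomp C X alpha (alpha w) u (half_pair C X alpha (alpha w) u).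
  by rewrite /half_pair; case: xgetP => [g -> //|/(_ (g1, g2))/(_ dec)].
rewrite swapD; last by apply: (half_decomp_gain hp); rewrite inE.
congr (_ - _); rewrite -(rep_Psi pi) hp -scalerDr linearZ linearD /= scalerA.
by rewrite mulf_div [2 * _]mulrC divff ?scale1r // mulf_neq0 ?card_cell_neq0 ?pnatr_eq0.
Qed.

(** The coefficients of the reflection are real. *)
Lemma cell_reflection_adj (f : V -> 'M[C]_d) u :
  R (fun w => (f w)^t*) u = (R f u)^t*.
Proof.
rewrite /R /cell_reflection; case: ifP => // _.
rewrite linearB /= map_mxB linearZ /= map_mxZ; congr (_ *: _ - _).
  by rewrite fmorph_div !rmorph_nat.
by rewrite linear_sum /= map_mx_sum.
Qed.

(** Both sides are the sum of all blocks between the two cells: by the partition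
    condition all row sums agree, and all column sums are adjoints of row sums
    of the transposed pair of cells. *)
Lemma cell_double_sum u w : alpha u != ord0 -> alpha w != ord0 ->
  #|cell alpha (alpha u)|%:R *: \sum_(b in cell alpha (alpha w)) B u b
    = #|cell alpha (alpha w)|%:R *: \sum_(a in cell alpha (alpha u)) B a w.
Proof.
move=> u0 w0; case: gm => _ gm1 _.
transitivity (\sum_(a in cell alpha (alpha u)) \sum_(b in cell alpha (alpha w)) B a b).
  rewrite scaler_nat -sumr_const; apply: eq_bigr => a ua.
  by rewrite -!rep_Psi; apply: (gm1 _ _ u0 w0 _ _ _ ua); rewrite inE.
rewrite exchange_big /= scaler_nat -sumr_const; apply: eq_bigr => b wb.
rewrite -!rep_Psi_adj //.
by congr (_ ^t*); apply: (gm1 _ _ w0 u0 _ _ wb); rewrite inE.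
Qed.

Lemma switched_block u w : B' u w = R (fun a => R (B a) w) u.
Proof.
have [u0|u0] := eqVneq (alpha u) ord0.
  by rewrite switched_block_C0 // {2}/R /cell_reflection u0 eqxx.
have [w0|w0] := eqVneq (alpha w) ord0.
  rewrite /B' gain_blockC // -/(B' w u) switched_block_C0 // -cell_reflection_adj.
  apply: eq_cell_reflection => a; rewrite -gain_blockC //.
  by rewrite /R /cell_reflection w0 eqxx.
transitivity (B u w).
  rewrite /B' /gain_block gain0_switchedE /switched_gain0.
  by rewrite (negbTE u0) (negbTE w0).
have e := cell_double_sum u0 w0.
have nu0 := card_cell_neq0 C alpha u; have nw0 := card_cell_neq0 C alpha w.
set r := \sum_(b in _) B u b in e; set c := \sum_(a in _) B a w in e.
(* The reflected rows in the cell of u all have the same correction term. *)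
have rowR a : a \in cell alpha (alpha u) ->
    R (B a) w = (2 / #|cell alpha (alpha w)|%:R) *: r - B a w.
  case: gm => _ gm1 _ ua; rewrite /R /cell_reflection (negbTE w0) /r -!rep_Psi.
  by congr (_ *: _ - _); apply: (gm1 _ _ u0 w0 _ _ ua); rewrite inE.
(* By double counting these terms add up to 2 c. *)
have sumR : \sum_(a in cell alpha (alpha u)) R (B a) w = c.
  rewrite (eq_bigr _ rowR) sumrB sumr_const -scaler_nat scalerA mulrC -scalerA e.
  by rewrite scalerA divfK // scaler_nat mulr2n addrK.
rewrite {1}/R /cell_reflection (negbTE u0) sumR rowR ?inE //.
suff -> : (2 / #|cell alpha (alpha u)|%:R) *: c
    = (2 / #|cell alpha (alpha w)|%:R) *: r by rewrite subKr.
have -> : r = #|cell alpha (alpha u)|%:R^-1 *: (#|cell alpha (alpha w)|%:R *: c).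
  by rewrite -e scalerA mulVf ?scale1r.
by rewrite !scalerA mulrAC divfK.
Qed.

Lemma rep_adj_mx n (v : 'I_n -> V) (Y : gain_graph G V) :
  rep_mx pi (adj_mx C v Y) = vertex_block v (gain_block pi Y).
Proof.
apply: eq_mxblock => i j; rewrite mxE /gain_block /rep_opt /gain0.
by case: ifP.
Qed.

Lemma rep_Q_mx n (v : 'I_n -> V) : rep_mx pi (Q_mx C G v alpha)
  = vertex_block v (fun u w => Q_coef C alpha u w *: 1%:M).
Proof.
apply: eq_mxblock => i j; rewrite mxE /= -(rep1 pi) -rep_algU -linearZ /=.
congr (rep_alg pi _); rewrite /Q_coef.
case: ifP => _; first by case: eqP => _; rewrite ?scale1r ?scale0r.
case: eqP => [<-|_]; last by case: eqP; rewrite subr0 ?mulr1 // mulr0 scale0r.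
by rewrite eqxx mulr1 mulrBl divff ?card_cell_neq0.
Qed.

Lemma rep_switched n (v : 'I_n -> V) : bijective v ->
  rep_mx pi (adj_mx C v (switched C X alpha))
    = rep_mx pi (Q_mx C G v alpha) *m rep_mx pi (adj_mx C v X)
        *m rep_mx pi (Q_mx C G v alpha).
Proof.
move=> hv; rewrite !rep_adj_mx rep_Q_mx -mulmxA.
rewrite mul_vertex_block_Q // mul_Q_vertex_block //.
by apply: eq_vertex_block => u w; apply: switched_block.
Qed.

Lemma switched_cospectral n (v : 'I_n -> V) : bijective v ->
  pi_cospectral pi v X v (switched C X alpha).
Proof.
move=> hv x; rewrite /pi_spectrum /spectrum rep_switched //.
by rewrite char_poly_involution_conj // rep_Q_mx Q_involutive.
Qed.

End Switching.

Theorem theorem4p4 (R : realType) (G : groupType) (V : finType)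
    (n : nat) (v : 'I_n -> V) (hv : bijective v)
    (X : gain_graph G V)
    (d : nat) (pi : representation R[i] G d) (hpi : unitary_rep pi)
    (k : nat) (alpha : V -> 'I_k.+1) (halpha : gm_partition pi X alpha) :
  rep_mx pi (adj_mx R[i] v (switched R[i] X alpha))
    = rep_mx pi (Q_mx R[i] G v alpha) *m rep_mx pi (adj_mx R[i] v X)
        *m rep_mx pi (Q_mx R[i] G v alpha)
  /\ pi_cospectral pi v X v (switched R[i] X alpha).
Proof.
split; first exact: (rep_switched hpi halpha hv).
exact: (switched_cospectral hpi halpha hv).
Qed.
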